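(* Consider the following over-the-air federated learning setting. There are $N$ devices indexed by $\mathcal{N}=\{1,\dots,N\}$, each device $n$ having a local objective $L_n:\mathbb{R}^d\to\mathbb{R}$, and the global objective is $L(\boldsymbol m)=\frac1N\sum_{n=1}^N L_n(\boldsymbol m)$. Let $\boldsymbol m^*$ be a global minimizer of $L$ and $\boldsymbol m_n^*=[m^*_{n,1},\dots,m^*_{n,d}]$ a minimizer of $L_n$; write $\boldsymbol m^*=[m_1^*,\dots,m_d^*]$ and $$\Gamma=\max_n\Big\{\frac{\theta d}{2}\big(\max_i |m_i^*-m_{n,i}^*|\big)^2\Big\}.$$ In round $t$ the server holds $\boldsymbol m^t$; a nonempty uploader set $\mathcal K^t\subseteq\mathcal N$ and a jammer set $\mathcal J^t\subseteq\mathcal N\setminus\mathcal K^t$ are chosen. Each uploader sets $\boldsymbol m_n^t=\boldsymbol m^t$ and computes a stochastic (mini-batch) gradient $\boldsymbol g_n^t$ of $L_n$ at $\boldsymbol m_n^t$. Let $p_{n,B}^t=h_{n,B}^t\sqrt{P_n}>0$, where $h_{n,B}^t>0$ is the channel gain from device $n$ to the server and $P_n>0$ its power budget. The server update is $$\boldsymbol m^{t+1}=\boldsymbol m^t-\tau^t\Big(\hat{\boldsymbol g}^t+\frac{G}{\sum_{n\in\mathcal K^t}p_{n,B}^t}\boldsymbol r_{B,Tot}^t\Big),\qquad \hat{\boldsymbol g}^t=\sum_{n\in\mathcal K^t}\frac{p_{n,B}^t}{\sum_{k\in\mathcal K^t}p_{k,B}^t}\boldsymbol g_n^t,$$ where $\boldsymbol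 r_{B,Tot}^t=\sum_{n\in\mathcal J^t}\frac{p_{n,B}^t}{\sqrt d}\boldsymbol e_n^t+\boldsymbol r_B^t$, with $\boldsymbol e_n^t\sim\mathcal N(0,\mathbf I_d)$ and $\boldsymbol r_B^t\sim\mathcal N(0,\sigma_B\mathbf I_d)$ mutually independent and independent of the gradients. Assume: (A1) $\mathbb E[\boldsymbol g_n^t]=\nabla L_n(\boldsymbol m_n^t)$, $\mathbb E\|\boldsymbol g_n^t-\nabla L_n(\boldsymbol m_n^t)\|_2^2\le\vartheta^2$, $\mathbb E\|\boldsymbol g_n^t\|_2\le G$; (A2) each $L_n$ is $\theta$-smooth: $L_n(\boldsymbol\iota')-L_n(\boldsymbol\iota)\le(\boldsymbol\iota'-\boldsymbol\iota)^{\mathrm T}\nabla L_n(\boldsymbol\iota)+\frac\theta2\|\boldsymbol\iota'-\boldsymbol\iota\|_2^2$ for all $\boldsymbol\iota,\boldsymbol\iota'$; (A3) each $L_n$ is $\rho$-strongly convex: $L_n(\boldsymbol\iota')-L_n(\boldsymbol\iota)\ge(\boldsymbol\iota'-\boldsymbol\iota)^{\mathrm T}\nabla L_n(\boldsymbol\iota)+\frac\rho2\|\boldsymbol\iota'-\boldsymbol\iota\|_2^2$ for all $\boldsymbol\iota,\boldsymbol\iota'$. Let $\varrho$ be a constant with $\frac1\varrho\le\tau^t\le\frac1\theta$. Then $$\mathbb E\big[\|\boldsymbol m^{t+1}-\boldsymbol m^*\|_2^2\big]\le(1-\rho\tau^t)\,\mathbb E\big[\|\boldsymbol m^t-\boldsymbol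 m^*\|_2^2\big]+(\tau^t)^2\big(2\varrho\Gamma+\vartheta^2+G^2\Psi^t\big),$$ where $$\Psi^t=\frac{N\sum_{n\in\mathcal J^t}(p_{n,B}^t)^2+d\sigma_B}{\big(\sum_{n\in\mathcal K^t}p_{n,B}^t\big)^2}.$$ The expectation is with respect to the stochastic gradients and the Gaussian noise.
   Context: $G>0$ is a constant which, as a standing assumption of the paper, upper bounds $\|\boldsymbol g_n^t\|_2$. $\sigma_B$ denotes the variance (per coordinate) of the receiver noise at the server. The jamming vectors $\boldsymbol e_n^t$ are artificial Gaussian noise sent by jammer devices; uploaders transmit $\frac{\sqrt{P_n}}{G}\boldsymbol g_n^t$ and the server post-processes the superimposed received signal by multiplying by $G/\sum_{n\in\mathcal K^t}p^t_{n,B}$, which yields the stated update. *)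

(* Defs.v *)
From HB Require Import structures.
From mathcomp Require Import all_boot all_order all_algebra.
From mathcomp Require Import all_classical all_reals all_analysis.
Set Implicit Arguments. Unset Strict Implicit. Unset Printing Implicit Defensive.
Import Order.TTheory GRing.Theory Num.Theory.
Local Open Scope classical_set_scope.
Local Open Scope ring_scope.

Section OTAFL.
Context {R : realType} {d : nat}.

Definition sqnorm (v : 'rV[R]_d) : R := \sum_(i < d) (v 0 i) ^+ 2.
Definition dotv (u v : 'rV[R]_d) : R := \sum_(i < d) u 0 i * v 0 i.

Context {dT : measure_display} {T : measurableType dT} (P : probability T R).

Definition rvec_meas (X : T -> 'rV[R]_d) :=
  forall c : 'I_d, measurable_fun setT (fun w => X w 0 c).

Definition rect_event (X : T -> 'rV[R]_d) (B : 'I_d -> set R) : set T :=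
  [set w | forall c, B c (X w 0 c)].

(* E[Y | sigma(X)] = 0 : Y integrable and its integral over every event of
   the generating pi-system of sigma(X) vanishes *)
Definition cond_mean_zero (Y : T -> R) (X : T -> 'rV[R]_d) :=
  P.-integrable setT (EFin \o Y) /\
  forall B : 'I_d -> set R, (forall c, measurable (B c)) ->
    (\int[P]_(w in rect_event X B) (Y w)%:E = 0)%E.

(* X ~ N(0, s^2 I_d): coordinates i.i.d. normal with mean 0, std. dev. s *)
Definition gauss_vec (X : T -> 'rV[R]_d) (s : R) :=
  forall B : 'I_d -> set R, (forall c, measurable (B c)) ->
    P (rect_event X B) = (\prod_(c < d) normal_prob 0 s (B c))%E.

Definition groups_indep (I : finType) (S : {set I}) (K : nat)
    (X : I -> 'I_K -> T -> 'rV[R]_d) :=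
  forall B : I -> 'I_K -> 'I_d -> set R, (forall i j c, measurable (B i j c)) ->
    P (\bigcap_(i in [set i | i \in S]) \bigcap_(j in setT) rect_event (X i j) (B i j))
    = (\prod_(i in S) P (\bigcap_(j in setT) rect_event (X i j) (B i j)))%E.

(* The groups of the round: group None = (m^t, (g_n^t)_{n in K}) (for n not in K
   the slot is filled with m^t again); group Some None = r_B^t;
   group Some (Some n) = e_n^t, used for n in J.  Single vectors are
   replicated to fill the N+1 slots (this does not change the generated
   sigma-algebra). *)
Definition round_groups (N : nat) (K : {set 'I_N}) (m : T -> 'rV[R]_d)
    (g e : 'I_N -> T -> 'rV[R]_d) (rB : T -> 'rV[R]_d) :
    option (option 'I_N) -> 'I_N.+1 -> T -> 'rV[R]_d :=
  fun i j => match i with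
    | None => match unlift ord0 j with
              | Some n => if n \in K then g n else m
              | None => m end
    | Some None => rB
    | Some (Some n) => e n
    end.

Definition round_index_set (N : nat) (J : {set 'I_N}) : {set option (option 'I_N)} :=
  None |: (Some None |: [set Some (Some n) | n in J]).

End OTAFL.

(* Main.v *)
(** With [a] the exact averaged gradient step from [m] minus [m*], [y_n] the
    gradient errors and [Z] the scaled noise, the next error vector is
    [a - tau (sum_n w_n y_n) - Z].  Smoothness and strong convexity give, for every
    sample, [|a|^2 <= (1 - rho tau) |m - m*|^2 + 2 tau Gamma], and
    [1 <= varrho tau].  Convexity of the square bounds the error term by [vartheta^2]
    and the jamming term by [N] times a sum of second moments, so it remains to
    see that all cross terms have mean zero.  Each of them is a product [F(U) Y]
    where [F] is Lipschitz ([grad L_n] is [theta]-Lipschitz) and [Y] integrates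
    to zero over every rectangle in [U]; rounding [U] to a grid of mesh [eps]
    makes the mean vanish exactly at the price of an [O(eps)] error. *)
Require Import Defs.
From HB Require Import structures.
From mathcomp Require Import all_boot all_order all_algebra.
From mathcomp Require Import all_classical all_reals all_analysis.
From mathcomp Require Import measurable_realfun ring lra.
Set Implicit Arguments. Unset Strict Implicit. Unset Printing Implicit Defensive.
Import Order.TTheory GRing.Theory Num.Theory.
Local Open Scope classical_set_scope.
Local Open Scope ring_scope.

(** * First two moments of a centred Gaussian variable *)

Section gaussian_moments.
Context {R : realType}.

(** The Radon-Nikodym derivative of the normal law and [normal_pdf] have the same integral over
    every measurable set, hence agree almost everywhere; the rest is a change of measure. *)
Lemma ge0_integral_normal_prob (a s : R) (f : R -> \bar R) :
  measurable_fun setT f -> (forall x, 0 <= f x)%E ->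
  (\int[normal_prob a s]_x f x =
   \int[lebesgue_measure]_x (f x * (normal_pdf a s x)%:E))%E.
Proof.
move=> mf f0.
have dom := @normal_prob_dominates R a s.
rewrite -(Radon_Nikodym_SigmaFinite.change_of_variables dom)//.
have fint := Radon_Nikodym_SigmaFinite.f_integrable dom.
apply: ae_eq_integral => //.
- by apply: emeasurable_funM => //; exact: measurable_int fint.
- by apply: emeasurable_funM => //; apply/measurable_EFinP; exact: measurable_normal_pdf.
- apply: ae_eqe_mul2l; apply: integral_ae_eq => //.
  + by apply/measurable_EFinP; exact: measurable_normal_pdf.
  + by move=> E _ mE; rewrite -Radon_Nikodym_SigmaFinite.f_integral.
Qed.

Context {dT : measure_display} {T : measurableType dT} (P : probability T R).

Lemma ge0_integral_gaussian {X : T -> R} {s : R} {f : R -> R} :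
  measurable_fun setT X ->
  (forall B, measurable B -> P (X @^-1` B) = normal_prob 0 s B) ->
  measurable_fun setT f -> (forall x, 0 <= f x) ->
  (\int[P]_w (f (X w))%:E =
   \int[lebesgue_measure]_x (f x * normal_pdf 0 s x)%:E)%E.
Proof.
move=> mX lawX mf f0.
have mf' : measurable_fun [set: measurableTypeR R] (EFin \o f).
  exact/measurable_EFinP.
have mX' : measurable_fun setT (X : T -> measurableTypeR R) by exact: mX.
pose Xf : {mfun T >-> measurableTypeR R} :=
  HB.pack X (isMeasurableFun.Build _ _ _ _ _ mX').
have -> : (\int[P]_w (f (X w))%:E = \int[distribution P Xf]_x (f x)%:E)%E.
  by rewrite (@ge0_integral_distribution _ _ _ _ _ _ Xf (EFin \o f)).
rewrite (@eq_measure_integral _ _ _ _ (normal_prob 0 s)); last first.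
  by move=> A mA _; exact: lawX.
rewrite (@ge0_integral_normal_prob _ _ (EFin \o f))//.
Qed.

(* [exp (v X)] is chosen so that the density of X becomes a multiple of another
   normal density; normalization then gives its mean, and [1 + u <= exp u]
   turns this into bounds on the first two moments without computing any
   further Gaussian integral. *)
Lemma gaussian_exp_moment (X : T -> R) (v : R -> R) (s k a' s' : R) :
  measurable_fun setT X ->
  (forall B, measurable B -> P (X @^-1` B) = normal_prob 0 s B) ->
  measurable_fun setT v -> 0 <= k ->
  (forall x, expR (v x) * normal_pdf 0 s x = k * normal_pdf a' s' x) ->
  P.-integrable setT (EFin \o (fun w => expR (v (X w)))) /\
  (\int[P]_w (expR (v (X w)))%:E = k%:E)%E.
Proof.
move=> mX lawX mv k0 E.
have mev : measurable_fun setT (fun x => expR (v x)) by exact: measurableT_comp.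
have I : (\int[P]_w (expR (v (X w)))%:E = k%:E)%E.
  rewrite (ge0_integral_gaussian mX lawX mev (fun=> expR_ge0 _)).
  under eq_integral do rewrite E EFinM.
  rewrite ge0_integralZl_EFin//.
  - by rewrite integral_normal_pdf mule1.
  - by move=> x _; rewrite lee_fin normal_pdf_ge0.
  - by apply/measurable_EFinP; exact: measurable_normal_pdf.
split => //; apply/integrableP; split.
  by apply/measurable_EFinP; apply: (measurableT_comp mev).
under eq_integral do rewrite /= ger0_norm ?expR_ge0//.
by rewrite I ltry.
Qed.


Lemma normal_peakM (s : R) : 0 < s ->
  normal_peak s * s = (Num.sqrt (pi *+ 2))^-1.
Proof.
move=> s0; rewrite /normal_peak -mulrnAr sqrtrM ?sqr_ge0// sqrtr_sqr gtr0_norm//.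
by rewrite invfM mulrAC mulVf ?gt_eqF// mul1r.
Qed.

(** The tilt [exp (a X^2)] with [a = (s^-2 - s'^-2) / 2] turns the density of deviation [s] into
    [s' / s] times that of deviation [s']. So its mean is [s' / s], and [1 + a X^2 <= exp (a X^2)]
    bounds the second moment by [(s' / s - 1) / a], which simplifies to the stated fraction. *)
Lemma gaussian_sqr_integrable (X : T -> R) (s s' : R) :
  measurable_fun setT X ->
  (forall B, measurable B -> P (X @^-1` B) = normal_prob 0 s B) ->
  0 < s -> s < s' ->
  P.-integrable setT (EFin \o (fun w => X w ^+ 2)) /\
  (\int[P]_w (X w ^+ 2)%:E <= (2 * s * s' ^+ 2 / (s + s'))%:E)%E.
Proof.
move=> mX lawX s0 ss'.
have s'0 : 0 < s' by exact: lt_trans ss'.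
pose a := (s ^- 2 - s' ^- 2) / 2.
have a0 : 0 < a.
  by rewrite divr_gt0// subr_gt0 ltf_pV2 ?posrE ?exprn_gt0// ltr_pXn2r// nnegrE ltW.
have [||x|iE IE] := @gaussian_exp_moment X (fun x => a * x ^+ 2) s (s' / s) 0 s' mX lawX.
- by apply: measurable_funM => //; exact: measurable_funX.
- by rewrite divr_ge0// ltW.
- rewrite !normal_pdfE ?gt_eqF//.
  have -> : normal_peak s = s' / s * normal_peak s'.
    apply: (mulIf (x := s)); rewrite ?gt_eqF//.
    by rewrite normal_peakM// mulrAC divfK ?gt_eqF// mulrC normal_peakM.
  have -> : normal_fun 0 s' x = expR (a * x ^+ 2) * normal_fun 0 s x.
    rewrite /normal_fun -expRD; congr expR.
    by rewrite /a; field; rewrite !gt_eqF.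
  by ring.
have mX2 : measurable_fun setT (fun w => X w ^+ 2) by exact: measurable_funX.
have iX2 : P.-integrable setT (EFin \o (fun w => X w ^+ 2)).
  apply: (@le_integrable _ _ _ P setT measurableT _ (fun w => (a^-1)%:E * (expR (a * X w ^+ 2))%:E)%E).
  - exact/measurable_EFinP.
  - move=> w _; rewrite -EFinM !abse_EFin lee_fin !ger0_norm ?sqr_ge0//; last first.
      by rewrite mulr_ge0 ?expR_ge0// invr_ge0 ltW.
    rewrite ler_pdivlMl//.
    by rewrite (le_trans _ (expR_ge1Dx _))// lerDr.
  - exact: integrableZl.
split => //.
have : (\int[P]_w (1 + a * X w ^+ 2)%:E <= (s' / s)%:E)%E.
  rewrite -IE; apply: ge0_le_integral => //.
  - by move=> w _; rewrite lee_fin addr_ge0// mulr_ge0 ?sqr_ge0// ltW.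
  - apply/measurable_EFinP; apply: measurable_funD => //.
    by apply: measurable_funM.
  - exact: measurable_int iE.
  - by move=> w _; rewrite lee_fin expR_ge1Dx.
rewrite (eq_integral (fun w => 1%:E + a%:E * (X w ^+ 2)%:E))%E; last by move=> w _; rewrite EFinD EFinM.
rewrite integralD//; last 2 first.
- exact: finite_measure_integrable_cst.
- exact: integrableZl.
rewrite integralZl// integral_cst//= probability_setT mul1e.
have := integrable_fin_num measurableT iX2.
case: (\int[P]_w _)%E => // r _.
rewrite -EFinM -EFinD !lee_fin => H.
have {}H : r <= (s' / s - 1) / a.
  by rewrite ler_pdivlMr// mulrC lerBrDl.
apply: (le_trans H); rewrite le_eqVlt; apply/orP; left; apply/eqP.
rewrite /a; field; apply/and4P; split; rewrite gt_eqF//; nra.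
Qed.

(** The previous bound tends to [s^2] as [s'] decreases to [s]. *)
Lemma gaussian_moment2_le (X : T -> R) (s : R) :
  measurable_fun setT X ->
  (forall B, measurable B -> P (X @^-1` B) = normal_prob 0 s B) ->
  0 < s ->
  P.-integrable setT (EFin \o (fun w => X w ^+ 2)) /\
  (\int[P]_w (X w ^+ 2)%:E <= (s ^+ 2)%:E)%E.
Proof.
move=> mX lawX s0.
have s1 : s < s + 1 by rewrite ltrDl.
have [iX _] := gaussian_sqr_integrable mX lawX s0 s1.
split => //; apply/lee_addgt0Pr => e e0.
(* With [s' = s + t], the conditions [t <= s] and [4 s t <= e] give
   [2 s (s + t)^2 <= (s^2 + e) (2 s + t)]. *)
pose t := Num.min s (e / (4 * s)).
have t0 : 0 < t by rewrite lt_min s0 divr_gt0// mulr_gt0.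
have := (gaussian_sqr_integrable mX lawX s0 (s' := s + t) _).2.
rewrite ltrDl => /(_ t0) /le_trans; apply; rewrite -EFinD lee_fin.
have ts : t <= s by rewrite ge_min lexx.
have te : t * (4 * s) <= e by rewrite -ler_pdivlMr ?mulr_gt0// ge_min lexx orbT.
rewrite ler_pdivrMr; last by rewrite !addr_gt0.
nra.
Qed.

(** The tilt [exp (b X - b^2 s^2 / 2)] has mean 1, so [b E[X] <= b^2 s^2 / 2] for every real [b]; a
    right-hand side quadratic in [b] forces the mean to vanish. *)
Lemma gaussian_mean0 (X : T -> R) (s : R) :
  measurable_fun setT X ->
  (forall B, measurable B -> P (X @^-1` B) = normal_prob 0 s B) ->
  0 < s -> P.-integrable setT (EFin \o X) ->
  (\int[P]_w (X w)%:E = 0)%E.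
Proof.
move=> mX lawX s0 iX.
have key (b : R) : (b%:E * \int[P]_w (X w)%:E <= (b ^+ 2 * s ^+ 2 / 2)%:E)%E.
  have [|//|x|iE IE] := @gaussian_exp_moment X
      (fun x => b * x - b ^+ 2 * s ^+ 2 / 2) s 1 (b * s ^+ 2) s mX lawX.
  - by apply: measurable_funB => //; exact: measurable_funM.
  - rewrite !normal_pdfE ?gt_eqF// mul1r mulrCA; congr (_ * _).
    rewrite /normal_fun -expRD; congr expR.
    by field; rewrite gt_eqF.
  have : (\int[P]_w (1 + (b * X w - b ^+ 2 * s ^+ 2 / 2))%:E <= 1%:E)%E.
    rewrite -IE; apply: le_integral => //; last first.
      by move=> w _; rewrite lee_fin expR_ge1Dx.
    rewrite (_ : (fun w => _) = (fun w => (1 - b ^+ 2 * s ^+ 2 / 2)%:E + b%:E * (X w)%:E)%E); last first.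
      by apply/funext => w; rewrite -EFinM -EFinD; congr EFin; ring.
    apply: integrableD => //; first exact: finite_measure_integrable_cst.
    exact: integrableZl.
  rewrite (eq_integral (fun w => (1 - b ^+ 2 * s ^+ 2 / 2)%:E + b%:E * (X w)%:E)%E); last first.
    by move=> w _; rewrite -EFinM -EFinD; congr EFin; ring.
  rewrite integralD//; last 2 first.
  - exact: finite_measure_integrable_cst.
  - exact: integrableZl.
  rewrite integralZl// integral_cst//= probability_setT mule1.
  have := integrable_fin_num measurableT iX.
  case: (\int[P]_w _)%E => // r _.
  by rewrite -EFinM -EFinD !lee_fin; lra.
have := integrable_fin_num measurableT iX; move: key.
case: (\int[P]_w _)%E => // r key _; congr EFin.
(* This [b] minimizes [b^2 s^2 / 2 - b r]; the bound becomes [(r / s)^2 <= (r / s)^2 / 2]. *)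
have := key (r / s ^+ 2); rewrite -EFinM lee_fin.
have -> : r / s ^+ 2 * r = 2 * ((r / s) ^+ 2 / 2) by field; rewrite gt_eqF.
have -> : (r / s ^+ 2) ^+ 2 * s ^+ 2 / 2 = (r / s) ^+ 2 / 2 by field; rewrite gt_eqF.
move=> H; have /eqP : (r / s) ^+ 2 = 0.
  by apply/eqP; rewrite eq_le sqr_ge0 andbT; lra.
by rewrite sqrf_eq0 mulf_eq0 invr_eq0 (gt_eqF s0) orbF => /eqP.
Qed.

End gaussian_moments.

(** * Lipschitz functions for the sup distance *)

Section sup_lipschitz.
Context {R : realType} {I : Type}.

(** Stating closeness coordinatewise avoids a norm on [I -> R] and is exactly what rounding every
    coordinate to a grid provides. *)
Definition sup_lipschitz (F : (I -> R) -> R) := exists2 C : R, 0 <= C &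
  forall (eps : R) (u v : I -> R), 0 <= eps -> (forall i, `|u i - v i| <= eps) ->
    `|F u - F v| <= C * eps.

Lemma sup_lipschitz_proj i : sup_lipschitz (fun u => u i).
Proof. by exists 1 => // eps u v _ uv; rewrite mul1r. Qed.

Lemma sup_lipschitz_cst a : sup_lipschitz (fun=> a).
Proof. by exists 0 => // eps u v _ _; rewrite subrr normr0 mul0r. Qed.

Lemma sup_lipschitzD F G :
  sup_lipschitz F -> sup_lipschitz G -> sup_lipschitz (fun u => F u + G u).
Proof.
move=> [C C0 HF] [D D0 HG]; exists (C + D); first exact: addr_ge0.
move=> eps u v e0 uv; rewrite opprD addrACA mulrDl.
by rewrite (le_trans (ler_normD _ _))// lerD ?HF ?HG.
Qed.

Lemma sup_lipschitzM a F : sup_lipschitz F -> sup_lipschitz (fun u => a * F u).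
Proof.
move=> [C C0 HF]; exists (`|a| * C); first by rewrite mulr_ge0.
move=> eps u v e0 uv; rewrite -mulrBr normrM -mulrA.
by rewrite ler_wpM2l// HF.
Qed.

Lemma sup_lipschitzB F G :
  sup_lipschitz F -> sup_lipschitz G -> sup_lipschitz (fun u => F u - G u).
Proof.
move=> lF /(sup_lipschitzM (-1)) lG; have [C C0 H] := sup_lipschitzD lF lG.
by exists C => // eps u v e0 uv; have := H eps u v e0 uv; rewrite !mulN1r.
Qed.

Lemma sup_lipschitz_sum (J : Type) (r : seq J) (Q : pred J) F :
  (forall j, Q j -> sup_lipschitz (F j)) ->
  sup_lipschitz (fun u => \sum_(j <- r | Q j) F j u).
Proof.
move=> lF; elim: r => [|j r IH].
  rewrite (_ : (fun u => _) = fun=> 0); first exact: sup_lipschitz_cst.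
  by apply/funext => u; rewrite big_nil.
rewrite (_ : (fun u => _) = if Q j
    then fun u => F j u + \sum_(i <- r | Q i) F i u
    else fun u => \sum_(i <- r | Q i) F i u); last first.
  by apply/funext => u; rewrite big_cons; case: ifP.
by case: ifPn => // Qj; exact: sup_lipschitzD (lF _ Qj) IH.
Qed.

End sup_lipschitz.

(** * Vanishing means of products, by discretization *)

Section orthogonality.
Context {R : realType} {dT : measure_display} {T : measurableType dT}.
Variable P : probability T R.

Lemma measurable_rect (I : finType) (U : I -> T -> R) (B : I -> set R) :
  (forall i, measurable_fun setT (U i)) -> (forall i, measurable (B i)) ->
  measurable [set w | forall i, B i (U i w)].
Proof.
move=> mU mB.
rewrite (_ : [set w | _] = \bigcap_(i in [set: I]) (U i @^-1` B i)); last first.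
  by apply/seteqP; split => w /= H i; [move=> _|]; apply: H.
apply: fin_bigcap_measurable => // i _.
by rewrite -[X in measurable X]setTI; exact: mU.
Qed.

(* The grid cells of mesh [eps] are countably many rectangles, on each of which
   the discretized factor is constant, so no monotone class argument is needed. *)
Lemma integral_rect_lipschitz_eq0 (I : finType) (U : I -> T -> R)
    (F : (I -> R) -> R) (Y : T -> R) :
  sup_lipschitz F -> (forall i, measurable_fun setT (U i)) ->
  P.-integrable setT (EFin \o Y) ->
  (forall B : I -> set R, (forall i, measurable (B i)) ->
    \int[P]_(w in [set w | forall i, B i (U i w)]) (Y w)%:E = 0)%E ->
  P.-integrable setT (EFin \o (fun w => F (U^~ w) * Y w)) ->
  (\int[P]_w (F (U^~ w) * Y w)%:E = 0)%E.
Proof.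
move=> [C C0 HF] mU iY Y0 iFY.
have mY : measurable_fun setT Y by exact/measurable_EFinP/(measurable_int P).
pose M := fine (\int[P]_w `|(Y w)%:E|)%E.
have iaY : P.-integrable setT (abse \o (EFin \o Y)) by exact: integrable_abse.
have ME : (\int[P]_w `|(Y w)%:E| = M%:E)%E.
  by rewrite /M fineK//; exact: (integrable_fin_num measurableT iaY).
suff key (eps : R) : 0 < eps -> (`|\int[P]_w (F (U^~ w) * Y w)%:E| <= (C * eps * M)%:E)%E.
  apply/eqP; rewrite -abse_eq0; apply/eqP/le_anti; rewrite abse_ge0 andbT.
  have CM0 : 0 <= C * M.
    by rewrite mulr_ge0// -lee_fin -ME integral_ge0.
  apply/lee_addgt0Pr => e e0; rewrite add0e.
  have D0 : 0 < C * M + 1 by rewrite ltr_wpDl.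
  apply: (le_trans (key (e / (C * M + 1)) _)); first by rewrite divr_gt0.
  rewrite lee_fin mulrAC mulrA ler_pdivrMr// mulrC ler_pM2l//.
  by rewrite lerDl.
move=> e0.
pose B (z : {ffun I -> int}) i := [set x : R | Num.floor (x / eps) = z i].
pose E (z : {ffun I -> int}) := [set w | forall i, B z i (U i w)].
have mB z i : measurable (B z i).
  rewrite (_ : B z i = `[(z i)%:~R * eps, (z i + 1)%:~R * eps[%classic).
    exact: measurable_itv.
  apply/seteqP; split => x /=; rewrite in_itv/= -ler_pdivlMr// -ltr_pdivrMr//.
    by move=> <-; rewrite ge_floor lt_succ_floor.
  by move=> H; apply/floor_def.
have mE z : measurable (E z) by exact: measurable_rect (mU) (mB z).
pose q w : {ffun I -> int} := [ffun i => Num.floor (U i w / eps)].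
have Eq z w : E z w <-> q w = z.
  split => [H|<- i]; last by rewrite /B/= ffunE.
  by apply/ffunP => i; rewrite ffunE; exact: H.
(* [F] is evaluated at the lower corner of the cell containing [U w], which moves no coordinate by
   more than [eps]. *)
pose G w := F (fun i => (q w i)%:~R * eps).
have mG : measurable_fun setT G.
  move=> _ A mA; rewrite setTI.
  rewrite (_ : _ @^-1` _ = \bigcup_(z in [set: {ffun I -> int}]) (if F (fun i => (z i)%:~R * eps) \in A then E z else set0)).
    apply: countable_bigcupT_measurable => [|z]; last by case: ifP.
    exact: countableP.
  apply/seteqP; split => [w Aw|w [z _]].
    by exists (q w) => //; rewrite mem_set//; apply/Eq.
  by case: ifPn => // /set_mem Az /Eq qz; rewrite /G/= qz.
have FG w : `|F (U^~ w) - G w| <= C * eps.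
  apply: HF; first exact: ltW.
  move=> i; rewrite ffunE.
  rewrite -[X in `|X - _|](divfK (lt0r_neq0 e0)) -mulrBl normrM.
  rewrite [X in _ * X]gtr0_norm// ler_piMl ?(ltW e0)//.
  rewrite ger0_norm ?subr_ge0 ?ge_floor// lerBlDl.
  by have := lt_succ_floor (U i w / eps); rewrite intrD addrC => /ltW.
have iGY : P.-integrable setT (EFin \o (fun w => G w * Y w)).
  pose FY w : R := F (U^~ w) * Y w.
  apply: (@le_integrable _ _ _ P setT measurableT _
      ((abse \o (EFin \o FY)) \+
       (fun w => (C * eps)%R%:E * `|(Y w)%:E|))%E).
  - exact/measurable_EFinP/measurable_funM.
  - move=> w _ /=; rewrite lee_fin /FY.
    rewrite [leRHS]ger0_norm; last by rewrite addr_ge0// !mulr_ge0// ltW.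
    rewrite (_ : G w * Y w = F (U^~ w) * Y w - (F (U^~ w) - G w) * Y w); last by ring.
    rewrite (le_trans (ler_normB _ _))// lerD2l normrM ler_wpM2r//.
  - by apply: integrableD => //; [exact: integrable_abse|exact: integrableZl].
have GY0 : (\int[P]_w (G w * Y w)%:E = 0)%E.
  (* The cells are enumerated by naturals; a natural that codes no cell gets the empty set. *)
  pose S k := if @pickle_inv {ffun I -> int} k is Some z then E z else set0.
  have UT : [set: T] = \bigcup_k S k.
    apply/seteqP; split => // w _; exists (pickle (q w)) => //.
    by rewrite /S pickleK_inv; apply/Eq.
  rewrite UT integral_bigcup.
  - apply: eseries0 => k _ _; rewrite /S; case: pickle_inv => [z|]; last first.
      by rewrite integral_set0.
    rewrite (eq_integral (fun w => (F (fun i => (z i)%:~R * eps))%:E * (Y w)%:E)%E); last first.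
      by move=> w /set_mem /Eq qz; rewrite EFinM /G qz.
    rewrite integralZl//; last exact: integrableS iY.
    by rewrite Y0 ?mule0.
  - move=> k l _ _ [w []]; rewrite /S.
    case Ek: pickle_inv => [z|//]; case El: pickle_inv => [z'|//].
    move=> /Eq qz /Eq qz'.
    have := pickle_invK (T:={ffun I -> int}) k; have := pickle_invK (T:={ffun I -> int}) l.
    by rewrite Ek El/= -qz -qz' => -> ->.
  - by move=> k; rewrite /S; case: pickle_inv.
  - by rewrite -UT.
have -> : (\int[P]_w (F (U^~ w) * Y w)%:E
          = \int[P]_w ((F (U^~ w) * Y w)%:E - (G w * Y w)%:E))%E.
  by rewrite integralB_EFin// GY0 sube0.
have iD : P.-integrable setT (fun w => (F (U^~ w) * Y w)%:E - (G w * Y w)%:E)%E.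
  exact: integrableB.
apply: (le_trans (le_abse_integral P measurableT (measurable_int P iD))).
rewrite EFinM -ME -integralZl//.
apply: ge0_le_integral => //.
- by apply: measurableT_comp => //; exact: measurable_int iD.
- by move: (integrableZl measurableT (C * eps) iaY) => /measurable_int.
- move=> w _; rewrite -EFinB -mulrBl !abse_EFin -EFinM lee_fin normrM.
  by rewrite ler_wpM2r.
Qed.

(* The roles are exchanged here: Y is discretized, and independence says that
   [1_E - P E] integrates to zero over every [Y @^-1` B]. *)
Lemma indep_integral_eq0 (E : set T) (Y : T -> R) :
  measurable E -> P.-integrable setT (EFin \o Y) ->
  (forall B, measurable B -> P (E `&` Y @^-1` B) = (P E * P (Y @^-1` B))%E) ->
  (\int[P]_w (Y w)%:E = 0)%E ->
  (\int[P]_(w in E) (Y w)%:E = 0)%E.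
Proof.
move=> mE iY ind Y0.
have mY : measurable_fun setT Y by exact/measurable_EFinP/(measurable_int P).
pose c := fine (P E).
have cE : P E = c%:E by rewrite fineK// fin_num_measure.
pose Z w : R := \1_E w - c.
have mZ : measurable_fun setT Z by apply: measurable_funB => //; exact: measurable_indic.
have iZ : P.-integrable setT (EFin \o Z).
  rewrite (_ : _ \o _ = (fun w => (\1_E w)%:E - c%:E)%E)//.
  apply: integrableB => //; first exact: integrable_indic.
  exact: finite_measure_integrable_cst.
have iYE : P.-integrable setT (fun w => (Y w * \1_E w)%:E).
  rewrite (_ : (fun w => _) = ((EFin \o Y) \* (EFin \o \1_E))%E)//.
  apply: integrableMl => //=.
  exists 1; split => // x x1/= w _; rewrite (le_trans _ (ltW x1))// ger0_norm//.
have YZ : (fun w => (Y w * Z w)%:E) = (fun w => (Y w * \1_E w)%:E - c%:E * (Y w)%:E)%E.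
  by apply/funext => w; rewrite -EFinM -EFinB /Z; congr EFin; ring.
have iYZ : P.-integrable setT (EFin \o (fun w => Y w * Z w)).
  rewrite /comp YZ; apply: integrableB => //; exact: integrableZl.
have := @integral_rect_lipschitz_eq0 unit (fun=> Y) (fun u => u tt) Z
  (sup_lipschitz_proj tt) (fun=> mY) iZ _ iYZ.
rewrite YZ integralB//; last exact: integrableZl.
rewrite integralZl// Y0 mule0 sube0 => H.
rewrite integral_mkcond -[RHS]H; last first.
  move=> B mB.
  have mYB : measurable (Y @^-1` B tt).
    by rewrite -[X in measurable X]setTI; exact: mY.
  rewrite (_ : [set w | _] = Y @^-1` B tt); last first.
    by apply/seteqP; split => [w /(_ tt)//|w ? []].
  rewrite (eq_integral (fun w => (\1_E w)%:E - (cst c%:E w))%E)//.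
  rewrite integralB//; last 2 first.
  - apply: (integrableS measurableT) => //; exact: integrable_indic.
  - exact: finite_measure_integrable_cst.
  rewrite integral_indic// integral_cst//=.
  have /= -> := ind _ (mB tt).
  have /= -> := cE; rewrite subee//.
  by rewrite fin_numM// fin_num_measure.
apply: eq_integral => w _; rewrite patchE indicE.
by case: ifPn => _; rewrite ?mulr1 ?mulr0.
Qed.

End orthogonality.

(** * Euclidean algebra and convexity of the square *)

Section euclidean.
Context {R : realType} {d : nat}.
Implicit Types u v w : 'rV[R]_d.

Lemma sqnorm_ge0 v : 0 <= sqnorm v.
Proof. by apply: sumr_ge0 => i _; exact: sqr_ge0. Qed.

Lemma dotvv v : dotv v v = sqnorm v.
Proof. by apply: eq_bigr => i _; rewrite expr2. Qed.

Lemma dotvZr a u v : dotv u (a *: v) = a * dotv u v.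
Proof. by rewrite /dotv mulr_sumr; apply: eq_bigr => i _; rewrite mxE mulrCA. Qed.

Lemma dotvBr u v w : dotv u (v - w) = dotv u v - dotv u w.
Proof. by rewrite /dotv -sumrB; apply: eq_bigr => i _; rewrite !mxE mulrBr. Qed.

Lemma dotvDl u v w : dotv (v + w) u = dotv v u + dotv w u.
Proof. by rewrite /dotv -big_split; apply: eq_bigr => i _; rewrite !mxE mulrDl. Qed.

Lemma dotvZl a u v : dotv (a *: u) v = a * dotv u v.
Proof. by rewrite /dotv mulr_sumr; apply: eq_bigr => i _; rewrite mxE mulrA. Qed.

Lemma dotv_sumr (I : finType) (A : {pred I}) u (f : I -> 'rV[R]_d) :
  dotv u (\sum_(i in A) f i) = \sum_(i in A) dotv u (f i).
Proof.
rewrite /dotv exchange_big; apply: eq_bigr => c _.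
by rewrite summxE mulr_sumr.
Qed.

Lemma sqnormZ a v : sqnorm (a *: v) = a ^+ 2 * sqnorm v.
Proof. by rewrite /sqnorm mulr_sumr; apply: eq_bigr => i _; rewrite mxE exprMn. Qed.

Lemma sqnormB u v : sqnorm (u - v) = sqnorm u - 2 * dotv u v + sqnorm v.
Proof.
rewrite /sqnorm /dotv mulr_sumr -sumrB -big_split; apply: eq_bigr => i _ /=.
by rewrite !mxE; ring.
Qed.

Lemma sqnormBC u v : sqnorm (u - v) = sqnorm (v - u).
Proof. by apply: eq_bigr => i _; rewrite !mxE -sqrrN opprB. Qed.

Lemma sqr_coord_le_sqnorm v i : v 0 i ^+ 2 <= sqnorm v.
Proof.
by rewrite /sqnorm (bigD1 i)//= lerDl sumr_ge0// => j _; exact: sqr_ge0.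
Qed.

Lemma dotvC u v : dotv u v = dotv v u.
Proof. by apply: eq_bigr => i _; rewrite mulrC. Qed.

Lemma dotvDr u v w :
  dotv w (u + v) = dotv w u + dotv w v.
Proof. by rewrite dotvC dotvDl !(dotvC w). Qed.

Lemma sqnormD u v :
  sqnorm (u + v) = sqnorm u + 2 * dotv u v + sqnorm v.
Proof. by rewrite -!dotvv dotvDl !dotvDr (dotvC v u); ring. Qed.

Lemma dotv_wsumr (I : finType) (A : {pred I})
    (q : I -> R) u (f : I -> 'rV[R]_d) :
  dotv u (\sum_(i in A) q i *: f i) = \sum_(i in A) q i * dotv u (f i).
Proof. by rewrite dotv_sumr; apply: eq_bigr => i _; rewrite dotvZr. Qed.

End euclidean.

(** Weighted Cauchy-Schwarz, from expanding a sum of squares of [W x_i - S]. Since [W] only bounds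
    the total weight, it covers both convex weights ([W = 1]) and unit weights on a subset of the
    devices ([W = N]). *)
Lemma sqr_wsum_le {R : realType} (I : finType) (A : {pred I}) (w x : I -> R) (W : R) :
  (forall i, i \in A -> 0 <= w i) -> \sum_(i in A) w i <= W -> 0 < W ->
  (\sum_(i in A) w i * x i) ^+ 2 <= W * \sum_(i in A) w i * x i ^+ 2.
Proof.
move=> w0 wW W0; set S := \sum_(i in A) w i * x i; set Q := \sum_(i in A) _.
have : 0 <= \sum_(i in A) w i * (W * x i - S) ^+ 2.
  by apply: sumr_ge0 => i iA; rewrite mulr_ge0 ?w0// sqr_ge0.
have -> : \sum_(i in A) w i * (W * x i - S) ^+ 2
        = W ^+ 2 * Q - 2 * W * S * S + S ^+ 2 * \sum_(i in A) w i.
  transitivity (\sum_(i in A) (W ^+ 2 * (w i * x i ^+ 2)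
      - 2 * W * S * (w i * x i) + S ^+ 2 * w i)).
    by apply: eq_bigr => i _; ring.
  by rewrite big_split sumrB -!mulr_sumr.
move=> H; have S0 := sqr_ge0 S.
have H2 : 0 <= W * (W * Q - S ^+ 2) by nra.
by move: H2; rewrite pmulr_rge0// subr_ge0.
Qed.

Lemma sqnorm_wsum_le {R : realType} (d : nat) (I : finType) (A : {pred I}) (w : I -> R)
    (v : I -> 'rV[R]_d) (W : R) :
  (forall i, i \in A -> 0 <= w i) -> \sum_(i in A) w i <= W -> 0 < W ->
  sqnorm (\sum_(i in A) w i *: v i) <= W * \sum_(i in A) w i * sqnorm (v i).
Proof.
move=> w0 wW W0; rewrite /sqnorm.
under [in leRHS]eq_bigr do rewrite mulr_sumr.
rewrite exchange_big mulr_sumr; apply: ler_sum => c _.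
rewrite summxE (eq_bigr (fun i => w i * v i 0 c)); last by move=> i _; rewrite mxE.
exact: sqr_wsum_le.
Qed.

(** * Smooth convex functions and the exact gradient step *)

Section smooth.
Context {R : realType} {d : nat}.
Variables (f : 'rV[R]_d -> R) (df : 'rV[R]_d -> 'rV[R]_d) (theta : R).
Hypothesis theta0 : 0 < theta.
Hypothesis smooth : forall x x',
  f x' - f x <= dotv (x' - x) (df x) + theta / 2 * sqnorm (x' - x).

(** A gradient step of length [theta^-1] from [x] lowers [f] by at least [|df x|^2 / (2 theta)], and
    cannot go below the minimum. *)
Lemma sqnorm_grad_le x0 x : (forall y, f x0 <= f y) ->
  sqnorm (df x) <= 2 * theta * (f x - f x0).
Proof.
move=> min; have := smooth x (x - theta^-1 *: df x).
rewrite addrAC subrr sub0r -scaleNr dotvZl sqnormZ dotvv.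
have := min (x - theta^-1 *: df x); rewrite -scaleNr.
set y := f (_ + _); set s := sqnorm _ => ymin H.
have E : - theta^-1 * s + theta / 2 * ((- theta^-1) ^+ 2 * s) = - (s / (2 * theta)).
  by field; rewrite gt_eqF.
rewrite E in H.
have : s / (2 * theta) <= f x - f x0 by lra.
by rewrite ler_pdivrMr ?mulr_gt0// mulrC.
Qed.

Lemma grad_min_eq0 x0 : (forall y, f x0 <= f y) -> df x0 = 0.
Proof.
move=> min; have := sqnorm_grad_le x0 min; rewrite subrr mulr0 => s0.
apply/rowP => i; rewrite mxE; apply/eqP; rewrite -sqrf_eq0; apply/eqP/le_anti.
by rewrite sqr_ge0 andbT (le_trans (sqr_coord_le_sqnorm _ _)).
Qed.

Lemma smooth_gap_le x0 x : (forall y, f x0 <= f y) ->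
  f x - f x0 <= theta / 2 * sqnorm (x - x0).
Proof.
move=> min; have := smooth x0 x; rewrite grad_min_eq0//.
have -> : dotv (x - x0) 0 = 0 by rewrite -(scale0r 0) dotvZr mul0r.
by rewrite add0r.
Qed.

(* Testing the upper bound at y against the lower bound at x in the point
   y + (df x - df y) / theta. *)
Lemma smooth_convex_grad_lipschitz x y :
  (forall x x', f x' - f x >= dotv (x' - x) (df x)) ->
  sqnorm (df x - df y) <= theta ^+ 2 * sqnorm (x - y).
Proof.
move=> cvx; set D := df x - df y; pose z := y + theta^-1 *: D.
have H1 := cvx x z; have H2 := smooth y z; have H3 := smooth x y.
have E1 : z - x = (y - x) + theta^-1 *: D by rewrite /z addrAC.
have E2 : z - y = theta^-1 *: D by rewrite /z addrAC subrr add0r.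
rewrite E1 dotvDl dotvZl in H1; rewrite E2 dotvZl sqnormZ in H2.
have HD : dotv D (df x) - dotv D (df y) = sqnorm D by rewrite -dotvBr dotvv.
rewrite (sqnormBC x).
set s := sqnorm D in HD H2 *; set q := sqnorm (y - x) in H3 *.
have E : theta / 2 * (theta^-1 ^+ 2 * s) = theta^-1 * s / 2.
  by field; rewrite gt_eqF.
rewrite E in H2.
have HD' : theta^-1 * dotv D (df x) = theta^-1 * dotv D (df y) + theta^-1 * s.
  by rewrite -HD; ring.
(* [H2] and [H3] add up to an upper bound on [f z - f x], and [H1] is a lower one. The terms in
   [y - x] cancel, leaving [theta^-1 s <= theta^-1 s / 2 + theta q / 2]. *)
have : theta^-1 * s <= theta * q by lra.
by rewrite mulrC ler_pdivrMr// => /le_trans; apply; rewrite mulrAC expr2.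
Qed.

End smooth.

(** Transfers a Euclidean Lipschitz bound to the sup distance; [h] selects the coordinates forming
    the vector inside a possibly larger family. The constant grows by [d] rather than its square
    root, using [d <= d^2]. *)
Lemma sup_lipschitz_row {R : realType} (d : nat) (I : Type) (G : 'rV[R]_d -> R)
    (h : 'I_d -> I) (C : R) : 0 <= C ->
  (forall x y, (G x - G y) ^+ 2 <= C ^+ 2 * sqnorm (x - y)) ->
  sup_lipschitz (fun u : I -> R => G (\row_c u (h c))).
Proof.
move=> C0 HG; exists (C * d%:R); first by rewrite mulr_ge0.
move=> eps u v e0 uv.
rewrite -ler_sqr ?nnegrE// ?mulr_ge0// real_normK ?num_real//.
apply: (le_trans (HG _ _)); rewrite -mulrA exprMn ler_wpM2l ?sqr_ge0//.
apply: (@le_trans _ _ (\sum_(i < d) eps ^+ 2)).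
  apply: ler_sum => i _; rewrite !mxE -real_normK ?num_real//.
  by rewrite ler_sqr ?nnegrE.
rewrite sumr_const card_ord -[leLHS]mulr_natl exprMn ler_wpM2r ?sqr_ge0//.
by rewrite -natrX ler_nat expnS expn1; case: (d) => // n; rewrite leq_pmulr.
Qed.

(** After convexity of the square, each device is treated separately. Strong convexity bounds the
    cross term, and smoothness bounds the squared gradient by [2 theta] times the gap
    [L n x - L n (mloc n)]. The gap then carries the factor [- 2 tau (1 - tau theta) <= 0], and only
    [2 tau (L n mstar - L n (mloc n)) <= 2 tau c] survives. *)
Lemma gradient_step_contraction {R : realType} (d N : nat)
  (L : 'I_N -> 'rV[R]_d -> R) (gradL : 'I_N -> 'rV[R]_d -> 'rV[R]_d)
  (mstar : 'rV[R]_d) (mloc : 'I_N -> 'rV[R]_d) (theta rho tau c : R)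
  (K : {pred 'I_N}) (w : 'I_N -> R) (x : 'rV[R]_d) :
  0 < theta ->
  (forall n x x', L n x' - L n x <= dotv (x' - x) (gradL n x) + theta / 2 * sqnorm (x' - x)) ->
  (forall n x x', L n x' - L n x >= dotv (x' - x) (gradL n x) + rho / 2 * sqnorm (x' - x)) ->
  (forall n x, L n (mloc n) <= L n x) ->
  0 < tau -> tau <= theta^-1 ->
  (forall n, n \in K -> 0 <= w n) -> \sum_(n in K) w n = 1 ->
  (forall n, theta / 2 * sqnorm (mstar - mloc n) <= c) ->
  sqnorm (x - mstar - tau *: \sum_(n in K) w n *: gradL n x) <=
    (1 - rho * tau) * sqnorm (x - mstar) + 2 * tau * c.
Proof.
move=> th0 A2 A3 min t0 tth w0 w1 hc; set z := x - mstar.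
rewrite sqnormB dotvZr sqnormZ dotv_sumr.
under eq_bigr do rewrite dotvZr.
have := @sqnorm_wsum_le _ _ _ K w (fun n => gradL n x) 1 w0.
rewrite w1 lexx ltr01 mul1r => /(_ isT isT).
set S := sqnorm (\sum_(_ in _) _) => HS.
have t2 : 0 <= tau ^+ 2 by exact: sqr_ge0.
have HS2 := ler_wpM2l t2 HS.
have tth1 : tau * theta <= 1 by rewrite -ler_pdivlMr// div1r.
have key n : n \in K -> w n * (tau ^+ 2 * sqnorm (gradL n x) - 2 * tau * dotv z (gradL n x))
    <= w n * (2 * tau * c - rho * tau * sqnorm z).
  move=> nK; apply: ler_wpM2l; first exact: w0.
  have H3 := A3 n x mstar.
  have Eg := sqnorm_grad_le th0 (A2 n) x (min n).
  have Em := smooth_gap_le th0 (A2 n) mstar (min n).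
  have gap0 : 0 <= L n x - L n (mloc n) by rewrite subr_ge0.
  have hcn := hc n.
  have Ez : dotv (mstar - x) (gradL n x) = - dotv z (gradL n x).
    by rewrite -mulN1r -dotvZl scaleN1r opprB.
  rewrite Ez (sqnormBC mstar) -/z in H3.
  have H4 := ler_wpM2l (ltW t0) H3.
  have H5 := ler_wpM2l t2 Eg.
  have H6 : tau * (1 - tau * theta) * (L n x - L n (mloc n)) >= 0.
    by rewrite mulr_ge0// mulr_ge0 ?subr_ge0// ltW.
  have H7 := ler_wpM2l (ltW t0) (le_trans Em hcn).
  nra.
have : \sum_(n in K) w n * (tau ^+ 2 * sqnorm (gradL n x) - 2 * tau * dotv z (gradL n x))
    <= \sum_(n in K) w n * (2 * tau * c - rho * tau * sqnorm z) by exact: ler_sum.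
rewrite -mulr_suml w1 mul1r.
rewrite (_ : \sum_(n in K) _ = tau ^+ 2 * (\sum_(n in K) w n * sqnorm (gradL n x))
    - 2 * tau * \sum_(n in K) w n * dotv z (gradL n x)); last first.
  by rewrite !mulr_sumr -sumrB; apply: eq_bigr => n _; ring.
move=> H; nra.
Qed.

(** * Calculus of bounded and vanishing means *)

Section mean_bounds.
Context {R : realType} {dT : measure_display} {T : measurableType dT}.
Variable P : probability T R.
Implicit Types f g : T -> R.

(** Integrability is bundled with the bound so that bounds can be added and scaled without meeting
    infinite values. *)
Definition mean_le f (c : R) :=
  P.-integrable setT (EFin \o f) /\ (\int[P]_w (f w)%:E <= c%:E)%E.

Definition centered f :=
  P.-integrable setT (EFin \o f) /\ (\int[P]_w (f w)%:E = 0)%E.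

Lemma mean_le_cst (c : R) : mean_le (fun=> c) c.
Proof.
split; first exact: (finite_measure_integrable_cst P c measurableT).
by rewrite integral_cst//= probability_setT mule1.
Qed.

Lemma mean_leD f g a b :
  mean_le f a -> mean_le g b -> mean_le (fun w => f w + g w) (a + b).
Proof.
move=> [fi fa] [gi gb]; split; first exact: (integrableD measurableT fi gi).
by rewrite (integralD_EFin measurableT fi gi) EFinD leeD.
Qed.

Lemma mean_leZ (k : R) f a :
  0 <= k -> mean_le f a -> mean_le (fun w => k * f w) (k * a).
Proof.
move=> k0 [fi fa]; split; first exact: (integrableZl measurableT k fi).
under eq_integral do rewrite EFinM.
by rewrite (integralZl measurableT fi) EFinM lee_wpmul2l.
Qed.

Lemma mean_le_sum (I : Type) (r : seq I) (Q : pred I) (f : I -> T -> R) (a : I -> R) :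
  (forall i, Q i -> mean_le (f i) (a i)) ->
  mean_le (fun w => \sum_(i <- r | Q i) f i w) (\sum_(i <- r | Q i) a i).
Proof.
move=> H; elim: r => [|i r IH].
  rewrite big_nil (_ : (fun w => _) = fun=> 0); first exact: mean_le_cst.
  by apply/funext => w; rewrite big_nil.
rewrite big_cons (_ : (fun w => _) = if Q i
    then fun w => f i w + \sum_(j <- r | Q j) f j w
    else fun w => \sum_(j <- r | Q j) f j w); last first.
  by apply/funext => w; rewrite big_cons; case: ifP.
by case: ifPn => // Qi; exact: mean_leD (H _ Qi) IH.
Qed.

Lemma centeredD f g : centered f -> centered g -> centered (fun w => f w + g w).
Proof.
move=> [fi f0] [gi g0]; split; first exact: (integrableD measurableT fi gi).
by rewrite (integralD_EFin measurableT fi gi) f0 g0 adde0.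
Qed.

Lemma centeredZ (k : R) f : centered f -> centered (fun w => k * f w).
Proof.
move=> [fi f0]; split; first exact: (integrableZl measurableT k fi).
under eq_integral do rewrite EFinM.
by rewrite (integralZl measurableT fi) f0 mule0.
Qed.

Lemma centered_sum (I : Type) (r : seq I) (Q : pred I) (f : I -> T -> R) :
  (forall i, Q i -> centered (f i)) ->
  centered (fun w => \sum_(i <- r | Q i) f i w).
Proof.
move=> H; elim: r => [|i r IH].
  rewrite (_ : (fun w => _) = cst 0); last by apply/funext => w; rewrite big_nil.
  by split; [exact: integrable0 | rewrite integral0].
rewrite (_ : (fun w => _) = if Q i
    then fun w => f i w + \sum_(j <- r | Q j) f j w
    else fun w => \sum_(j <- r | Q j) f j w); last first.
  by apply/funext => w; rewrite big_cons; case: ifP.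
by case: ifPn => // Qi; exact: centeredD (H _ Qi) IH.
Qed.

Lemma centered_mean_le f : centered f -> mean_le f 0.
Proof. by move=> [fi f0]; split => //; rewrite f0. Qed.

Lemma ge0_mean_le f (c : R) : measurable_fun setT f -> (forall w, 0 <= f w) ->
  (\int[P]_w (f w)%:E <= c%:E)%E -> mean_le f c.
Proof.
move=> mf f0 fc; split => //; apply/integrableP; split; first exact/measurable_EFinP.
under eq_integral do rewrite /= ger0_norm//.
by rewrite (le_lt_trans fc)// ltry.
Qed.

Lemma mean_le_dominated f g (c : R) : measurable_fun setT f ->
  (forall w, 0 <= f w) -> (forall w, f w <= g w) -> mean_le g c -> mean_le f c.
Proof.
move=> mf f0 fg [gi gc]; apply: ge0_mean_le => //; apply: le_trans gc.
apply: ge0_le_integral => //.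
- by move=> w _; rewrite lee_fin.
- exact/measurable_EFinP.
- exact: measurable_int gi.
- by move=> w _; rewrite lee_fin.
Qed.

Lemma integrable_sqr_mul f g : measurable_fun setT f -> measurable_fun setT g ->
  P.-integrable setT (EFin \o (fun w => f w ^+ 2)) ->
  P.-integrable setT (EFin \o (fun w => g w ^+ 2)) ->
  P.-integrable setT (EFin \o (fun w => f w * g w)).
Proof.
move=> mf mg f2 g2.
apply: (le_integrable (mu:=P) measurableT _ _ (integrableD measurableT f2 g2)).
  exact/measurable_EFinP/measurable_funM.
move=> w _ /=; rewrite lee_fin [leRHS]ger0_norm ?addr_ge0 ?sqr_ge0// normrM.
rewrite -(real_normK (num_real (f w))) -(real_normK (num_real (g w))).
have := sqr_ge0 (`|f w| - `|g w|); have := normr_ge0 (f w); have := normr_ge0 (g w).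
nra.
Qed.

Lemma integrable_sqr1 f : measurable_fun setT f ->
  P.-integrable setT (EFin \o (fun w => f w ^+ 2)) ->
  P.-integrable setT (EFin \o f).
Proof.
move=> mf f2.
rewrite (_ : f = fun w => f w * 1); last by apply/funext => w; rewrite mulr1.
apply: integrable_sqr_mul => //.
rewrite (_ : (fun w => _) = cst 1); last by apply/funext => w; rewrite expr1n.
exact: (finite_measure_integrable_cst P 1 measurableT).
Qed.

End mean_bounds.

(** * Consequences of the Gaussian laws and of independence *)

Section round_lemmas.
Context {R : realType} {d : nat} {dT : measure_display} {T : measurableType dT}.
Variable P : probability T R.

Lemma gauss_vec_coord (X : T -> 'rV[R]_d) (s : R) (c : 'I_d) : gauss_vec P X s ->
  forall B, measurable B -> P ((fun w => X w 0 c) @^-1` B) = normal_prob 0 s B.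
Proof.
move=> gX B mB.
have := gX (fun c' => if c' == c then B else setT).
rewrite (bigD1 c)//= eqxx big1 ?mule1; last first.
  by move=> i /negPf ->; rewrite /normal_prob integral_normal_pdf.
move=> <-; last by move=> c'; case: ifP.
congr (P _); apply/seteqP; split => w /=.
  by move=> H c'; case: eqP => // ->.
by move/(_ c); rewrite eqxx.
Qed.

Lemma gauss_vec_coord_moments (X : T -> 'rV[R]_d) (s : R) (c : 'I_d) :
  gauss_vec P X s -> 0 < s -> rvec_meas X ->
  mean_le P (fun w => X w 0 c ^+ 2) (s ^+ 2) /\ centered P (fun w => X w 0 c).
Proof.
move=> gX s0 mX; have [iX2 X2] := gaussian_moment2_le (mX c) (gauss_vec_coord c gX) s0.
have iX := integrable_sqr1 (mX c) iX2.
by split => //; split => //; exact: gaussian_mean0 (mX c) (gauss_vec_coord c gX) s0 iX.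
Qed.

(** Independence is tested on a rectangle over all slots of group [i0], on a single coordinate of
    slot [ord0] of group [i1], and on the whole space elsewhere. This is the product rule needed by
    [indep_integral_eq0]. *)
Lemma groups_indep_integral_eq0 (Ix : finType) (S : {set Ix}) (K : nat)
    (X : Ix -> 'I_K.+1 -> T -> 'rV[R]_d) (i0 i1 : Ix) (c : 'I_d)
    (B : 'I_K.+1 * 'I_d -> set R) :
  groups_indep P S X -> i0 \in S -> i1 \in S -> i0 != i1 ->
  (forall j, rvec_meas (X i0 j)) ->
  centered P (fun w => X i1 ord0 w 0 c) ->
  (forall jc, measurable (B jc)) ->
  (\int[P]_(w in [set w | forall jc, B jc (X i0 jc.1 w 0%R jc.2)])
     (X i1 ord0 w 0%R c)%:E = 0)%E.
Proof.
move=> ind i0S i1S i01 mX0 [iY Y0] mB.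
apply: indep_integral_eq0 => //.
  by apply: (measurable_rect (U := fun jc w => X i0 jc.1 w 0 jc.2)) => // jc; exact: mX0.
move=> A mA.
pose B' i j c' := if i == i0 then B (j, c')
  else if (i == i1) && (j == ord0) && (c' == c) then A else setT.
have mB' i j c' : measurable (B' i j c').
  by rewrite /B'; case: ifP => _; [exact: mB | case: ifP].
have E0 : \bigcap_(j in setT) rect_event (X i0 j) (B' i0 j)
    = [set w | forall jc, B jc (X i0 jc.1 w 0 jc.2)].
  rewrite /B' eqxx; apply/seteqP; split => w /= H.
    move=> [j c']. exact: (H j I c').
  by move=> j _ c'; exact: (H (j, c')).
have E1 : \bigcap_(j in setT) rect_event (X i1 j) (B' i1 j)
    = (fun w => X i1 ord0 w 0 c) @^-1` A.
  rewrite /B' eq_sym (negPf i01) eqxx; apply/seteqP; split => w /= H.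
    by have := H ord0 I c; rewrite !eqxx.
  move=> j _ c'; case: ifP => // /andP[/eqP -> /eqP ->]; exact: H.
have E2 i : i != i0 -> i != i1 ->
    \bigcap_(j in setT) rect_event (X i j) (B' i j) = setT.
  move=> /negPf n0 /negPf n1; rewrite /B' n0 n1; apply/seteqP; split => //.
have := ind B' mB'.
rewrite (bigD1 i0)//= (bigD1 i1)/=; last by rewrite i1S eq_sym.
rewrite E0 E1 big1 ?mule1; last first.
  by move=> i /andP[/andP[_ n0] n1]; rewrite E2// probability_setT.
move=> <-; congr (P _); apply/seteqP; split => w.
  move=> [H0 H1] i /= iS.
  have [->|n0] := eqVneq i i0; first by rewrite E0.
  have [->|n1] := eqVneq i i1; first by rewrite E1.
  by rewrite E2.
move=> H; have := H i0 i0S; have := H i1 i1S; rewrite E0 E1.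
by split.
Qed.

Lemma measurable_sqnorm (X : T -> 'rV[R]_d) :
  rvec_meas X -> measurable_fun setT (fun w => sqnorm (X w)).
Proof.
by move=> mX; apply: measurable_sum => c; apply: measurable_funX; exact: mX.
Qed.

End round_lemmas.

(** * Expectation of one noisy step *)

(** A bound for each sample: squares are estimated by convexity, while cross products keep their
    exact coefficients in the last group, so that they can vanish in the mean. The factor [N] bounds
    the number of jammers. *)
Lemma sqnorm_noisy_step_le {R : realType} (d N : nat) (K J : {set 'I_N})
    (wt q : 'I_N -> R) (a b r : 'rV[R]_d) (y e : 'I_N -> 'rV[R]_d) (tau k : R) :
  (0 < N)%N -> (forall n, n \in K -> 0 <= wt n) -> \sum_(n in K) wt n = 1 ->
  b = a - tau *: \sum_(n in K) wt n *: y n ->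
  sqnorm (b - k *: (\sum_(n in J) q n *: e n + r)) <=
    sqnorm a + tau ^+ 2 * (\sum_(n in K) wt n * sqnorm (y n))
    + k ^+ 2 * (N%:R * (\sum_(n in J) q n ^+ 2 * sqnorm (e n)) + sqnorm r)
    + ((- 2 * tau) * (\sum_(n in K) wt n * dotv a (y n))
       + (- 2 * k) * (\sum_(n in J) q n * dotv b (e n))
       + (- 2 * k) * dotv b r
       + (2 * k ^+ 2) * (\sum_(n in J) q n * dotv (e n) r)).
Proof.
move=> N0 w0 w1 bE.
set S := \sum_(n in J) q n *: e n.
have := sqnorm_wsum_le y w0 (lexx _); rewrite w1 mul1r => /(_ ltr01) HD.
have HS : sqnorm S <= N%:R * (\sum_(n in J) q n ^+ 2 * sqnorm (e n)).
  rewrite (_ : S = \sum_(n in J) 1 *: (q n *: e n)); last first.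
    by apply: eq_bigr => n _; rewrite scale1r.
  rewrite (_ : \sum_(n in J) _ = \sum_(n in J) 1 * sqnorm (q n *: e n)); last first.
    by apply: eq_bigr => n _; rewrite mul1r sqnormZ.
  apply: sqnorm_wsum_le => //; last by rewrite ltr0n.
  rewrite sumr_const ler_nat.
  by rewrite (leq_trans (max_card _))// card_ord.
rewrite sqnormB dotvZr dotvDr sqnormZ sqnormD.
have Eb : sqnorm b = sqnorm a - 2 * tau * (\sum_(n in K) wt n * dotv a (y n))
    + tau ^+ 2 * sqnorm (\sum_(n in K) wt n *: y n).
  by rewrite bE sqnormB dotvZr sqnormZ dotv_wsumr mulrA.
have -> : dotv b S = \sum_(n in J) q n * dotv b (e n) by exact: dotv_wsumr.
have -> : dotv S r = \sum_(n in J) q n * dotv (e n) r.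
  by rewrite dotvC dotv_wsumr; under eq_bigr do rewrite dotvC.
rewrite Eb.
have H1 := ler_wpM2l (sqr_ge0 tau) HD.
have H2 := ler_wpM2l (sqr_ge0 k) HS.
nra.
Qed.

Lemma centered_dotv {R : realType} {d : nat} {dT : measure_display}
    {T : measurableType dT} (P : probability T R) (u v : T -> 'rV[R]_d) :
  (forall c, centered P (fun w => u w 0 c * v w 0 c)) ->
  centered P (fun w => dotv (u w) (v w)).
Proof. by move=> H; apply: centered_sum => c _; exact: H. Qed.

Section expectation_step.
Context {R : realType} {d N : nat} {dT : measure_display} {T : measurableType dT}.
Variable P : probability T R.

(** The form in which every cross term is handled: square integrability supplies the integrability
    of the product, and [F] exhibits [f] as a Lipschitz function of [U]. *)
Lemma centered_rect_mul (I : finType) (U : I -> T -> R) (F : (I -> R) -> R)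
    (f Y : T -> R) :
  sup_lipschitz F -> (forall i, measurable_fun setT (U i)) ->
  (forall w, F (U^~ w) = f w) ->
  measurable_fun setT f -> P.-integrable setT (EFin \o (fun w => f w ^+ 2)) ->
  measurable_fun setT Y -> P.-integrable setT (EFin \o (fun w => Y w ^+ 2)) ->
  (forall B : I -> set R, (forall i, measurable (B i)) ->
    \int[P]_(w in [set w | forall i, B i (U i w)]) (Y w)%:E = 0)%E ->
  centered P (fun w => f w * Y w).
Proof.
move=> lF mU FE mf f2 mY Y2 Y0.
have iFY := integrable_sqr_mul mf mY f2 Y2.
split => //.
have E : (fun w => f w * Y w) = (fun w => F (U^~ w) * Y w).
  by apply/funext => w; rewrite FE.
under eq_integral do rewrite -FE.
apply: (integral_rect_lipschitz_eq0 lF mU (integrable_sqr1 mY Y2) Y0).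
by rewrite -E.
Qed.

Lemma integral_noisy_step_le (K J : {set 'I_N}) (wt q : 'I_N -> R)
    (a b r : T -> 'rV[R]_d) (y e : 'I_N -> T -> 'rV[R]_d)
    (tau k A0 V E1 E2 : R) :
  (0 < N)%N -> (forall n, n \in K -> 0 <= wt n) -> \sum_(n in K) wt n = 1 ->
  (forall w, b w = a w - tau *: \sum_(n in K) wt n *: y n w) ->
  mean_le P (fun w => sqnorm (a w)) A0 ->
  (forall n, n \in K -> mean_le P (fun w => sqnorm (y n w)) V) ->
  (forall n, n \in J -> mean_le P (fun w => sqnorm (e n w)) E1) ->
  mean_le P (fun w => sqnorm (r w)) E2 ->
  (forall n, n \in K -> forall c, centered P (fun w => a w 0 c * y n w 0 c)) ->
  (forall n, n \in J -> forall c, centered P (fun w => b w 0 c * e n w 0 c)) ->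
  (forall c, centered P (fun w => b w 0 c * r w 0 c)) ->
  (forall n, n \in J -> forall c, centered P (fun w => e n w 0 c * r w 0 c)) ->
  rvec_meas (fun w => b w - k *: (\sum_(n in J) q n *: e n w + r w)) ->
  (\int[P]_w (sqnorm (b w - k *: (\sum_(n in J) q n *: e n w + r w)))%:E <=
    (A0 + tau ^+ 2 * V + k ^+ 2 * (N%:R * (\sum_(n in J) q n ^+ 2 * E1) + E2))%:E)%E.
Proof.
move=> N0 w0 w1 bE Ha Hy He Hr cay cbe cbr cer mS.
pose bnd w := sqnorm (a w) + tau ^+ 2 * (\sum_(n in K) wt n * sqnorm (y n w))
    + k ^+ 2 * (N%:R * (\sum_(n in J) q n ^+ 2 * sqnorm (e n w)) + sqnorm (r w))
    + ((- 2 * tau) * (\sum_(n in K) wt n * dotv (a w) (y n w))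
       + (- 2 * k) * (\sum_(n in J) q n * dotv (b w) (e n w))
       + (- 2 * k) * dotv (b w) (r w)
       + (2 * k ^+ 2) * (\sum_(n in J) q n * dotv (e n w) (r w))).
(* Writing [V] as its own weighted average lets the variance bounds be summed device by device. *)
have VE : V = \sum_(n in K) wt n * V by rewrite -mulr_suml w1 mul1r.
have [ib Hb] : mean_le P bnd
    (A0 + tau ^+ 2 * V + k ^+ 2 * (N%:R * (\sum_(n in J) q n ^+ 2 * E1) + E2) + 0).
  apply: mean_leD; first apply: mean_leD; first apply: mean_leD => //.
  - apply: mean_leZ; first exact: sqr_ge0.
    rewrite VE; apply: mean_le_sum => n nK.
    by apply: mean_leZ; [exact: w0 | exact: Hy].
  - apply: mean_leZ; first exact: sqr_ge0.
    apply: mean_leD => //; apply: mean_leZ => //.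
    by apply: mean_le_sum => n nJ; apply: mean_leZ; [exact: sqr_ge0 | exact: He].
  - apply: centered_mean_le.
    apply: centeredD; first apply: centeredD; first apply: centeredD.
    + apply: centeredZ; apply: centered_sum => n nK; apply: centeredZ.
      by apply: centered_dotv => c; exact: cay.
    + apply: centeredZ; apply: centered_sum => n nK; apply: centeredZ.
      by apply: centered_dotv => c; exact: cbe.
    + by apply: centeredZ; exact: centered_dotv.
    + apply: centeredZ; apply: centered_sum => n nK; apply: centeredZ.
      by apply: centered_dotv => c; exact: cer.
rewrite addr0 in Hb; apply: le_trans Hb.
have le_bnd w : sqnorm (b w - k *: (\sum_(n in J) q n *: e n w + r w)) <= bnd w.
  exact: sqnorm_noisy_step_le.
apply: ge0_le_integral => //.
- by move=> w _; rewrite lee_fin sqnorm_ge0.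
- by apply/measurable_EFinP; exact: measurable_sqnorm mS.
- exact: measurable_int ib.
- by move=> w _; rewrite lee_fin.
Qed.

End expectation_step.

(** Each of the [d] squared coordinates is at most the square of the largest one. The default 0 of
    the maxima is harmless as all entries are nonnegative. *)
Lemma half_theta_sqnorm_le_bigmax {R : realType} (d N : nat) (theta : R) (mstar : 'rV[R]_d)
    (mloc : 'I_N -> 'rV[R]_d) (n : 'I_N) : 0 < theta ->
  theta / 2 * sqnorm (mstar - mloc n) <=
  \big[Num.max/0]_(n < N) (theta * d%:R / 2 *
     (\big[Num.max/0]_(i < d) `|mstar 0 i - mloc n 0 i|) ^+ 2).
Proof.
move=> th0; apply: le_trans (le_bigmax _ _ n).
set M2 := (X in _ <= _ * X); have -> : theta * d%:R / 2 * M2 = theta / 2 * (d%:R * M2) by ring.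
rewrite ler_wpM2l ?divr_ge0 ?(ltW th0)// /M2.
apply: (@le_trans _ _ (\sum_(i < d) (\big[Num.max/0]_(i < d) `|mstar 0 i - mloc n 0 i|) ^+ 2)).
  apply: ler_sum => i _; rewrite !mxE -real_normK ?num_real//.
  rewrite ler_sqr ?nnegrE//; first exact: le_bigmax.
  exact: bigmax_ge_id.
by rewrite sumr_const card_ord -[leLHS]mulr_natl.
Qed.

(** * The one-round bound *)

Theorem theorem1 (R : realType) (d N : nat)
  (dT : measure_display) (T : measurableType dT) (P : probability T R)
  (* objectives, their gradients, minimizers *)
  (L : 'I_N -> 'rV[R]_d -> R) (gradL : 'I_N -> 'rV[R]_d -> 'rV[R]_d)
  (mstar : 'rV[R]_d) (mloc : 'I_N -> 'rV[R]_d)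
  (* constants *)
  (theta rho vartheta G sigmaB varrho tau : R)
  (* round t: uploaders, jammers, channels, powers *)
  (K J : {set 'I_N}) (h Pw : 'I_N -> R)
  (* random objects of round t *)
  (m : T -> 'rV[R]_d) (g e : 'I_N -> T -> 'rV[R]_d) (rB : T -> 'rV[R]_d) :
  (* gradL n is the gradient of L n *)
  (forall n x v, is_derive (0 : R) (1 : R) (fun s : R => L n (x + s *: v))
                   (dotv (gradL n x) v)) ->
  (* m* is a global minimizer of L = 1/N sum_n L_n, mloc n a minimizer of L_n *)
  (forall x, N%:R^-1 * \sum_(n < N) L n mstar <= N%:R^-1 * \sum_(n < N) L n x) ->
  (forall n x, L n (mloc n) <= L n x) ->
  (* (A2) theta-smoothness, (A3) rho-strong convexity *)
  0 < theta -> 0 < rho ->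
  (forall n x x', L n x' - L n x <= dotv (x' - x) (gradL n x) + theta / 2 * sqnorm (x' - x)) ->
  (forall n x x', L n x' - L n x >= dotv (x' - x) (gradL n x) + rho / 2 * sqnorm (x' - x)) ->
  (* step size *)
  0 < varrho -> varrho^-1 <= tau -> tau <= theta^-1 ->
  (* uploader / jammer sets, channel gains, power budgets *)
  K != finset.set0 -> (forall n, n \in J -> n \notin K) ->
  (forall n, 0 < h n) -> (forall n, 0 < Pw n) ->
  0 < G -> 0 < sigmaB ->
  (* measurability *)
  rvec_meas m -> (forall n, n \in K -> rvec_meas (g n)) ->
  (forall n, n \in J -> rvec_meas (e n)) -> rvec_meas rB ->
  (* (A1) conditionally unbiased, bounded-variance, bounded stochastic gradients *)
  (forall n, n \in K -> forall c : 'I_d,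
      cond_mean_zero P (fun w => g n w 0 c - gradL n (m w) 0 c) m) ->
  (forall n, n \in K ->
      ('E_P[fun w => sqnorm (g n w - gradL n (m w))] <= (vartheta ^+ 2)%:E)%E) ->
  (forall n, n \in K -> ('E_P[fun w => Num.sqrt (sqnorm (g n w))] <= G%:E)%E) ->
  (* Gaussian noises, mutually independent and independent of (m^t, gradients) *)
  (forall n, n \in J -> gauss_vec P (e n) 1) ->
  gauss_vec P rB (Num.sqrt sigmaB) ->
  groups_indep P (round_index_set J) (round_groups K m g e rB) ->
  let p := fun n => h n * Num.sqrt (Pw n) in
  let Sp := \sum_(n in K) p n in
  let ghat := fun w => \sum_(n in K) (p n / Sp) *: g n w in
  let rTot := fun w => \sum_(n in J) (p n / Num.sqrt d%:R) *: e n w + rB w in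
  let mnext := fun w => m w - tau *: (ghat w + (G / Sp) *: rTot w) in
  let Gamma := \big[Num.max/0]_(n < N)
        (theta * d%:R / 2 * (\big[Num.max/0]_(i < d) `|mstar 0 i - mloc n 0 i|) ^+ 2) in
  let Psi := (N%:R * \sum_(n in J) p n ^+ 2 + d%:R * sigmaB) / Sp ^+ 2 in
  ('E_P[fun w => sqnorm (mnext w - mstar)]
     <= (1 - rho * tau)%:E * 'E_P[fun w => sqnorm (m w - mstar)]
        + (tau ^+ 2 * (2 * varrho * Gamma + vartheta ^+ 2 + G ^+ 2 * Psi))%:E)%E.
Proof.
move=> _ _ minloc th0 rho0 A2 A3 vr0 vtau tauth Kn0 _ h0 Pw0 G0 sB0 mm mg me mr
  unb var _ ge gr ind.
pose p n := h n * Num.sqrt (Pw n).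
pose Sp := \sum_(n in K) p n.
pose ghat w := \sum_(n in K) (p n / Sp) *: g n w.
pose rTot w := \sum_(n in J) (p n / Num.sqrt d%:R) *: e n w + rB w.
pose mnext w := m w - tau *: (ghat w + (G / Sp) *: rTot w).
pose Gamma := \big[Num.max/0]_(n < N)
  (theta * d%:R / 2 * (\big[Num.max/0]_(i < d) `|mstar 0 i - mloc n 0 i|) ^+ 2).
pose Psi := (N%:R * \sum_(n in J) p n ^+ 2 + d%:R * sigmaB) / Sp ^+ 2.
change ('E_P[fun w => sqnorm (mnext w - mstar)]
     <= (1 - rho * tau)%:E * 'E_P[fun w => sqnorm (m w - mstar)]
        + (tau ^+ 2 * (2 * varrho * Gamma + vartheta ^+ 2 + G ^+ 2 * Psi))%:E)%E.
have tau0 : 0 < tau by rewrite (lt_le_trans _ vtau)// invr_gt0.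
have p0 n : 0 < p n by rewrite mulr_gt0// sqrtr_gt0.
have [n0 n0K] : exists n, n \in K by apply/set0Pn.
have N0 : (0 < N)%N by exact: leq_ltn_trans (ltn_ord n0).
have Sp0 : 0 < Sp.
  by rewrite /Sp (bigD1 n0)//= ltr_wpDr// sumr_ge0// => i _; exact: ltW.
have Gam0 : 0 <= Gamma by exact: bigmax_ge_id.
have Psi0 : 0 <= Psi.
  rewrite divr_ge0 ?sqr_ge0// addr_ge0// mulr_ge0// ?(ltW sB0)// sumr_ge0// => i _.
  exact: sqr_ge0.
have C0 : 0 <= tau ^+ 2 * (2 * varrho * Gamma + vartheta ^+ 2 + G ^+ 2 * Psi).
  rewrite mulr_ge0 ?sqr_ge0// !addr_ge0 ?sqr_ge0//; last by rewrite mulr_ge0// sqr_ge0.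
  by rewrite !mulr_ge0// ltW.
(* In dimension 0 all norms vanish and [C0] suffices. Positive dimension is needed below to cancel
   [Num.sqrt d%:R] and to have a nonzero vector. *)
have [d0|d0] := posnP d.
  have sq0 (v : 'rV[R]_d) : sqnorm v = 0.
    by rewrite /sqnorm big1// => i; have := ltn_ord i; rewrite {2}d0.
  rewrite unlock; under eq_integral do rewrite sq0.
  under [X in (_ <= _ * X + _)%E]eq_integral do rewrite sq0.
  by rewrite !integral0 mule0 add0e lee_fin.
(* Smoothness and strong convexity are compared between 0 and the all-ones vector; with
   [tau <= theta^-1] this makes [1 - rho tau] nonnegative. *)
have rhotheta : rho <= theta.
  pose v : 'rV[R]_d := const_mx 1.
  have sv : 0 < sqnorm v.
    rewrite /sqnorm (eq_bigr (fun=> 1)); last by move=> i _; rewrite mxE expr1n.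
    by rewrite sumr_const card_ord ltr0n.
  have := le_trans (A3 n0 0 v) (A2 n0 0 v); rewrite subr0 lerD2l ler_pM2r//.
  by rewrite ler_pM2r ?invr_gt0.
have rt0 : 0 <= 1 - rho * tau.
  rewrite subr_ge0 (le_trans (ler_wpM2r (ltW tau0) rhotheta))//.
  by rewrite mulrC -ler_pdivlMr// div1r.
pose wt n := p n / Sp.
have w0 n : n \in K -> 0 <= wt n by move=> _; rewrite divr_ge0// ltW.
have w1 : \sum_(n in K) wt n = 1 by rewrite -mulr_suml divff// gt_eqF.
pose y n w := g n w - gradL n (m w).
(* [a] depends on [m] only and is paired with the gradient errors; [b] depends on [m] and the
   gradients and is paired with the noise. *)
pose a w := m w - mstar - tau *: \sum_(n in K) wt n *: gradL n (m w).
pose b w := a w - tau *: \sum_(n in K) wt n *: y n w.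
pose k := tau * (G / Sp).
pose q n := p n / Num.sqrt d%:R.
have mnextE w : mnext w - mstar = b w - k *: (\sum_(n in J) q n *: e n w + rB w).
  have gE : ghat w = \sum_(n in K) wt n *: gradL n (m w) + \sum_(n in K) wt n *: y n w.
    rewrite -big_split; apply: eq_bigr => n _ /=.
    by rewrite -scalerDr /y addrC subrK.
  rewrite /mnext gE /b /a -/(rTot w) /k.
  move: (rTot w) (\sum_(n in K) wt n *: y n w) (\sum_(n in K) wt n *: gradL n (m w)).
  by move=> u v z; apply/rowP => c; rewrite !mxE; ring.
have my n : n \in K -> rvec_meas (y n).
  move=> nK c; have [iY _] := unb n nK c.
  apply: (eq_measurable_fun (fun w => g n w 0 c - gradL n (m w) 0 c)).
    by move=> w _; rewrite /y !mxE.
  exact/measurable_EFinP/(measurable_int P iY).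
(* The integrability contained in [cond_mean_zero] makes [y n] measurable, so the gradient at [m] is
   measurable as the difference of [g n] and [y n]. *)
have mgrad n c : n \in K -> measurable_fun setT (fun w => gradL n (m w) 0 c).
  move=> nK; apply: (eq_measurable_fun (fun w => g n w 0 c - y n w 0 c)).
    by move=> w _; rewrite /y !mxE; ring.
  by apply: measurable_funB; [exact: mg | exact: my].
have aE w c : a w 0 c = m w 0 c - mstar 0 c - tau * \sum_(n in K) wt n * gradL n (m w) 0 c.
  by rewrite /a !mxE summxE; congr (_ - _ * _); apply: eq_bigr => n _; rewrite mxE.
have ma : rvec_meas a.
  move=> c; rewrite (_ : (fun w => _) = fun w => m w 0 c - mstar 0 c
      - tau * \sum_(n <- index_enum 'I_N) if n \in K then wt n * gradL n (m w) 0 c else 0).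
    apply: measurable_funB; first by apply: measurable_funB => //; exact: mm.
    apply: measurable_funM => //; apply: measurable_sum => n.
    by case: (boolP (n \in K)) => nK //; apply: measurable_funM => //; exact: mgrad.
  by apply/funext => w; rewrite aE big_mkcond.
have bE w c : b w 0 c = a w 0 c - tau * \sum_(n in K) wt n * y n w 0 c.
  rewrite /b; move: (a w) => v; rewrite !mxE summxE; congr (_ - _ * _).
  by apply: eq_bigr => n _; rewrite mxE.
have mb : rvec_meas b.
  move=> c; rewrite (_ : (fun w => _) = fun w => a w 0 c
      - tau * \sum_(n <- index_enum 'I_N) if n \in K then wt n * y n w 0 c else 0).
    apply: measurable_funB; first exact: ma.
    apply: measurable_funM => //; apply: measurable_sum => n.
    by case: (boolP (n \in K)) => nK //; apply: measurable_funM => //; exact: my.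
  by apply/funext => w; rewrite bE big_mkcond.
have cvx n x x' : L n x' - L n x >= dotv (x' - x) (gradL n x).
  by apply: le_trans (A3 n x x'); rewrite lerDl mulr_ge0 ?sqnorm_ge0// divr_ge0// ltW.
have lipgrad (I : Type) (hh : 'I_d -> I) n c :
    sup_lipschitz (fun u : I -> R => gradL n (\row_c' u (hh c')) 0 c).
  apply: (sup_lipschitz_row (G := fun x => gradL n x 0 c) _ (ltW th0)) => x x'.
  apply: le_trans (smooth_convex_grad_lipschitz th0 (A2 n) _ _ (cvx n)).
  by have := sqr_coord_le_sqnorm (gradL n x - gradL n x') c; rewrite !mxE.
have lipa (I : Type) (hh : 'I_d -> I) c : sup_lipschitz (fun u : I -> R =>
    u (hh c) - mstar 0 c - tau * \sum_(n in K) wt n * gradL n (\row_c' u (hh c')) 0 c).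
  apply: sup_lipschitzB.
    by apply: sup_lipschitzB; [exact: sup_lipschitz_proj | exact: sup_lipschitz_cst].
  by apply: sup_lipschitzM; apply: sup_lipschitz_sum => n _; exact: sup_lipschitzM.
have mmm : rvec_meas (fun w => m w - mstar).
  move=> c; apply: (eq_measurable_fun (fun w => m w 0 c - mstar 0 c)).
    by move=> w _; rewrite !mxE.
  by apply: measurable_funB => //; exact: mm.
have mU : measurable_fun setT (fun w => (1 - rho * tau) * sqnorm (m w - mstar)).
  by apply: measurable_funM => //; exact: measurable_sqnorm.
have EU : (\int[P]_w ((1 - rho * tau) * sqnorm (m w - mstar))%:E =
    (1 - rho * tau)%:E * \int[P]_w (sqnorm (m w - mstar))%:E)%E.
  under eq_integral do rewrite EFinM.
  rewrite ge0_integralZl_EFin//.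
  - by move=> w _; rewrite lee_fin sqnorm_ge0.
  - by apply/measurable_EFinP; exact: measurable_sqnorm.
(* An infinite [(1 - rho tau) E|m - m*|^2] makes the bound trivial.  Otherwise
   [a] is square integrable even when [1 - rho tau = 0] and m itself is not. *)
rewrite unlock -EU; set E0 := (\int[P]_w ((1 - rho * tau) * sqnorm (m w - mstar))%:E)%E in EU *.
have [->|E0fin] := eqVneq E0 +oo%E; first by rewrite addye ?leey.
have E00 : (0 <= E0)%E.
  by apply: integral_ge0 => w _; rewrite lee_fin mulr_ge0 ?sqnorm_ge0.
have [u E0u] : exists u, E0 = u%:E.
  by exists (fine E0); rewrite fineK// ge0_fin_numE// ltey.
rewrite E0u.
have HU : mean_le P (fun w => (1 - rho * tau) * sqnorm (m w - mstar)) u.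
  apply: ge0_mean_le => //; last by rewrite -E0u.
  by move=> w; rewrite mulr_ge0 ?sqnorm_ge0.
have Ha : mean_le P (fun w => sqnorm (a w)) (u + 2 * tau * Gamma).
  apply: mean_le_dominated (mean_leD HU (mean_le_cst P _)).
  - exact: measurable_sqnorm.
  - by move=> w; exact: sqnorm_ge0.
  - move=> w; apply: (gradient_step_contraction _ th0 A2 A3 minloc) => // n.
    exact: half_theta_sqnorm_le_bigmax.
have Hy n : n \in K -> mean_le P (fun w => sqnorm (y n w)) (vartheta ^+ 2).
  move=> nK; apply: ge0_mean_le.
  - by apply: measurable_sqnorm; exact: my.
  - by move=> w; exact: sqnorm_ge0.
  - by have := var n nK; rewrite unlock.
have He1 n c (nJ : n \in J) := gauss_vec_coord_moments c (ge n nJ) ltr01 (me n nJ).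
have He n : n \in J -> mean_le P (fun w => sqnorm (e n w)) d%:R.
  move=> nJ; rewrite (_ : d%:R = \sum_(i < d) 1 ^+ 2); last first.
    by rewrite expr1n sumr_const card_ord.
  by apply: mean_le_sum => c _; exact: (He1 n c nJ).1.
have ssB0 : 0 < Num.sqrt sigmaB by rewrite sqrtr_gt0.
have Hr1 c := gauss_vec_coord_moments c gr ssB0 mr.
have Hr : mean_le P (fun w => sqnorm (rB w)) (d%:R * sigmaB).
  rewrite (_ : d%:R * sigmaB = \sum_(i < d) Num.sqrt sigmaB ^+ 2); last first.
    by rewrite sumr_const card_ord sqr_sqrtr ?(ltW sB0)// mulr_natl.
  by apply: mean_le_sum => c _; exact: (Hr1 c).1.
have coord2 (X : T -> 'rV[R]_d) c0 c : rvec_meas X ->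
    mean_le P (fun w => sqnorm (X w)) c0 ->
    P.-integrable setT (EFin \o (fun w => X w 0 c ^+ 2)).
  move=> mX HX; have [] // := @mean_le_dominated _ _ _ P (fun w => X w 0 c ^+ 2) _ c0 _ _ _ HX.
  - by apply: measurable_funX; exact: mX.
  - by move=> w; exact: sqr_ge0.
  - by move=> w; exact: sqr_coord_le_sqnorm.
(* A crude bound, serving only to make the coordinates of [b] square integrable. *)
have Hb : mean_le P (fun w => sqnorm (b w))
    (2 * (u + 2 * tau * Gamma) + 2 * tau ^+ 2 * \sum_(n in K) wt n * vartheta ^+ 2).
  have bnd : mean_le P (fun w => 2 * sqnorm (a w)
      + 2 * tau ^+ 2 * \sum_(n in K) wt n * sqnorm (y n w))
      (2 * (u + 2 * tau * Gamma) + 2 * tau ^+ 2 * \sum_(n in K) wt n * vartheta ^+ 2).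
    apply: mean_leD; first exact: mean_leZ.
    apply: mean_leZ; first by rewrite mulr_ge0// sqr_ge0.
    by apply: mean_le_sum => n nK; apply: mean_leZ; [exact: w0 | exact: Hy].
  apply: mean_le_dominated bnd.
  - exact: measurable_sqnorm.
  - by move=> w; exact: sqnorm_ge0.
  - move=> w; have := sqnorm_wsum_le (fun n => y n w) w0 (lexx _).
    rewrite w1 mul1r => /(_ ltr01) H.
    have H1 := ler_wpM2l (sqr_ge0 tau) H.
    (* Parallelogram identity: [|u - v|^2 = 2 |u|^2 + 2 |v|^2 - |u + v|^2]. *)
    have := sqnorm_ge0 (a w + tau *: \sum_(n in K) wt n *: y n w).
    by rewrite /b; move: (a w) => v; rewrite sqnormD sqnormB !sqnormZ; lra.
have ib c := coord2 b _ c mb Hb.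
pose X := round_groups K m g e rB.
have mX j : rvec_meas (X None j).
  by rewrite /X /=; case: unlift => // n; case: ifP => // nK; exact: mg.
have SNone : None \in round_index_set J by rewrite !inE.
have Sr : Some None \in round_index_set J by rewrite !inE.
have Se n : n \in J -> Some (Some n) \in round_index_set J.
  by move=> nJ; rewrite !inE/= imset_f.
have rowm (v : 'rV[R]_d) : \row_c' v 0 c' = v by apply/rowP => c'; rewrite mxE.
have cay n : n \in K -> forall c, centered P (fun w => a w 0 c * y n w 0 c).
  move=> nK c; apply: (centered_rect_mul (lipa 'I_d id c) (U := fun i w => m w 0 i)) => //.
  - by move=> w; rewrite rowm aE.
  - exact: coord2 ma Ha.
  - exact: my.
  - by apply: coord2 (Hy n nK); exact: my.
  - move=> B mB; have [_ /(_ B mB) <-] := unb n nK c.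
    by apply: eq_integral => w _; rewrite /y !mxE.
(* [b] as a function of the group [None]: slot [ord0] holds [m], and slot [lift ord0 n] holds [g n]
   for [n] in [K]. *)
have lipb c : sup_lipschitz (fun u : 'I_N.+1 * 'I_d -> R =>
    (u (ord0, c) - mstar 0 c
     - tau * \sum_(n in K) wt n * gradL n (\row_c' u (ord0, c')) 0 c)
    - tau * \sum_(n in K) wt n *
        (u (lift ord0 n, c) - gradL n (\row_c' u (ord0, c')) 0 c)).
  apply: sup_lipschitzB; first exact: (lipa _ (fun c => (ord0, c)) c).
  apply: sup_lipschitzM; apply: sup_lipschitz_sum => n _; apply: sup_lipschitzM.
  apply: sup_lipschitzB; first exact: sup_lipschitz_proj.
  exact: (lipgrad _ (fun c => (ord0, c)) n c).
have cb i1 c : i1 \in round_index_set J -> None != i1 ->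
    rvec_meas (X i1 ord0) -> P.-integrable setT (EFin \o (fun w => X i1 ord0 w 0 c ^+ 2)) ->
    centered P (fun w => X i1 ord0 w 0 c) ->
    centered P (fun w => b w 0 c * X i1 ord0 w 0 c).
  move=> iS i1N mi ii ci.
  apply: (centered_rect_mul (lipb c) (U := fun jc w => X None jc.1 w 0 jc.2)) => //.
  - by move=> jc; exact: mX.
  - move=> w /=; rewrite unlift_none rowm bE aE; congr (_ - _ * _).
    by apply: eq_bigr => n nK; rewrite liftK nK /y !mxE.
  - by move=> B mB; apply: (groups_indep_integral_eq0 ind).
have cbe n : n \in J -> forall c, centered P (fun w => b w 0 c * e n w 0 c).
  move=> nJ c; have [[e2 _] e1] := He1 n c nJ.
  by apply: (cb (Some (Some n)) c) => //; [exact: Se | exact: me].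
have cbr c : centered P (fun w => b w 0 c * rB w 0 c).
  by have [[r2 _] r1] := Hr1 c; apply: (cb (Some None) c).
have cer n : n \in J -> forall c, centered P (fun w => e n w 0 c * rB w 0 c).
  move=> nJ c; have [[e2 _] e1] := He1 n c nJ; have [[r2 _] r1] := Hr1 c.
  apply: (centered_rect_mul (I := ('I_N.+1 * 'I_d)%type) (sup_lipschitz_proj (ord0, c))
    (U := fun jc w => X (Some (Some n)) jc.1 w 0 jc.2)) => //.
  - by move=> jc; exact: me.
  - exact: me.
  - move=> B mB; apply: (groups_indep_integral_eq0 ind (i1 := Some None)) => //.
      exact: Se.
    by move=> j; exact: me.
have mS : rvec_meas (fun w => b w - k *: (\sum_(n in J) q n *: e n w + rB w)).
  move=> c; rewrite (_ : (fun w => _) = fun w => b w 0 c - k *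
      (\sum_(n <- index_enum 'I_N) (if n \in J then q n * e n w 0 c else 0) + rB w 0 c)).
    apply: measurable_funB; first exact: mb.
    apply: measurable_funM => //; apply: measurable_funD; last exact: mr.
    apply: measurable_sum => n.
    by case: (boolP (n \in J)) => nJ //; apply: measurable_funM => //; exact: me.
  apply/funext => w; move: (b w) => v; rewrite !mxE summxE -big_mkcond.
  congr (_ - _ * (_ + _)).
  by apply: eq_bigr => n _; rewrite mxE.
under eq_integral do rewrite mnextE.
apply: le_trans (integral_noisy_step_le (q := q) (k := k) N0 w0 w1 (fun=> erefl)
  Ha Hy He Hr cay cbe cbr cer mS) _.
rewrite -EFinD lee_fin.
(* The bound [d] on the second moment of each jamming vector cancels the normalization by
   [Num.sqrt d%:R]. *)
have qE : \sum_(n in J) q n ^+ 2 * d%:R = \sum_(n in J) p n ^+ 2.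
  apply: eq_bigr => n _.
  by rewrite exprMn exprVn sqr_sqrtr// divfK// pnatr_eq0 -lt0n.
rewrite qE; have -> : k ^+ 2 * (N%:R * (\sum_(n in J) p n ^+ 2) + d%:R * sigmaB)
    = tau ^+ 2 * (G ^+ 2 * Psi).
  by rewrite /k /Psi; field; rewrite gt_eqF.
have vt1 : 1 <= varrho * tau by rewrite -ler_pdivrMl// mulr1.
(* Multiplying by [varrho * tau >= 1] trades the heterogeneity term of order [tau] for one of order
   [tau^2]. *)
have : 2 * tau * Gamma <= tau ^+ 2 * (2 * varrho * Gamma).
  have : 0 <= 2 * tau * Gamma * (varrho * tau - 1).
    by rewrite !mulr_ge0 ?subr_ge0// ltW.
  by nra.
by nra.
Qed.
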